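(* Let $G$ be a simple, $d$-regular, connected graph on $n$ vertices, let $k\ge1$ be an integer with $2k<n$, and let $\gamma$ be a random closed walk of length $2k$ in $G$ started at an arbitrary fixed vertex $x$. Then for every real $s>0$ with $s\le \min\left\{\frac18\left(\frac{k}{\log d}\right)^{1/4},\ \frac d2\right\}$, $$\Pr\left(\mathrm{support}(\gamma)\le s\right)\le \exp\left(-\frac{k}{100\,s^3}\right).$$
   Context: A simple graph is a finite undirected graph without multiedges or self-loops. A random closed walk of length $2k$ started at $x$ is a simple random walk $(X_0=x,X_1,\dots,X_{2k})$ on $G$ conditioned on $X_{2k}=X_0$ (equivalently, since $G$ is regular, a uniformly random closed walk of length $2k$ from $x$ to $x$). $\mathrm{support}(\gamma)$ is the number of distinct vertices visited by $\gamma$. $\log$ is the natural logarithm. *)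

(* Defs.v *)
From HB Require Import structures.
From mathcomp Require Import all_boot all_order all_algebra.
From mathcomp Require Import reals.

Set Implicit Arguments.
Unset Strict Implicit.
Unset Printing Implicit Defensive.

Import Order.TTheory GRing.Theory Num.Theory.
Local Open Scope ring_scope.

Section Graphs.
Variables (T : finType) (e : rel T).

Definition simple_graph : Prop := symmetric e /\ irreflexive e.

Definition degree (u : T) : nat := #|[set v | e u v]|.

Definition regular_graph (d : nat) : Prop := forall u, degree u = d.

Definition connected_graph : Prop := (0 < #|T|)%N /\ forall u v, connect e u v.

End Graphs.

Section RandomWalk.
Variables (R : realType) (T : finType) (e : rel T).

(* srw = simple random walk; a trajectory (X_0, ..., X_m) is encoded as a
   function w : {ffun 'I_m.+1 -> T}. *)
Definition srw_step (u v : T) : R := (e u v)%:R / (degree e u)%:R.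

Definition srw_law (x : T) (m : nat) (w : {ffun 'I_m.+1 -> T}) : R :=
  (w ord0 == x)%:R *
  \prod_(i < m) srw_step (w (widen_ord (leqnSn m) i)) (w (lift ord0 i)).

Definition srw_Pr (x : T) (m : nat) (A : pred {ffun 'I_m.+1 -> T}) : R :=
  \sum_(w | A w) srw_law x w.

Definition closed_walk (m : nat) (w : {ffun 'I_m.+1 -> T}) : bool :=
  w ord_max == w ord0.

(* Conditional probability of A given X_m = X_0; the junk value 0 when no
   closed walk exists is irrelevant for even m on a graph of positive degree. *)
Definition closed_walk_Pr (x : T) (m : nat) (A : pred {ffun 'I_m.+1 -> T}) : R :=
  srw_Pr x [pred w | closed_walk w && A w] / srw_Pr x (@closed_walk m).

End RandomWalk.

Definition walk_support (T : finType) (m : nat) (w : {ffun 'I_m.+1 -> T}) : nat :=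
  #|[set w i | i : 'I_m.+1]|.

(* Main.v *)
(** Fix a set S of at most m vertices, with 2m <= d, and let A and A_S be the
    adjacency operators of G and of the subgraph induced on S.  Every vertex of
    S has at least m neighbours outside S, so A^2 g >= A_S^2 g + m g pointwise
    for every g >= 0 supported on S.  As |A_S^2| <= m^2, each replacement of
    A_S^2 by A^2 in <1_x, A_S^(2k) 1_x> multiplies it by at least 1 + 1/m, so a
    closed walk from x stays in S with probability at most (1 + 1/m)^(-k).
    The support of a walk from x is built from {x} by repeatedly adding a
    neighbour of a vertex already present, so there are at most
    (1 + m d)^m <= d^(2m) candidates for S; a union bound gives
    exp (2 m log d - k / (2m)), which is small enough as k >= 4096 s^4 log d. *)
Require Import Defs.
From HB Require Import structures.
From mathcomp Require Import all_boot all_order all_algebra.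
From mathcomp Require Import reals sequences exp.
From mathcomp Require Import boolp ring lra.

Set Implicit Arguments.
Unset Strict Implicit.
Unset Printing Implicit Defensive.

Import Order.TTheory GRing.Theory Num.Theory.
Local Open Scope ring_scope.

(** * Adjacency operators and walk counting *)

Section Adjacency.
Variables (R : realType) (T : finType).
Implicit Types (r : rel T) (f g : T -> R).

Definition adj r f : T -> R := fun u => \sum_(v | r u v) f v.

Definition unit_at (x : T) : T -> R := fun u => (u == x)%:R.

Lemma iter_adj_ge0 r f m : (forall u, 0 <= f u) -> forall u, 0 <= iter m (adj r) f u.
Proof.
move=> f0; elim: m => [//|m IH] u /=.
by apply: sumr_ge0.
Qed.

Lemma le_iter_adj r f g m : (forall u, f u <= g u) ->
  forall u, iter m (adj r) f u <= iter m (adj r) g u.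
Proof.
move=> fg; elim: m => [//|m IH] u /=.
by apply: ler_sum.
Qed.

Lemma iter_adjDZ r f g (c : R) m :
  iter m (adj r) (fun u => f u + c * g u) =
  (fun u => iter m (adj r) f u + c * iter m (adj r) g u).
Proof.
elim: m => [//|m IH]; apply/funext => u /=.
by rewrite IH /adj big_split /= mulr_sumr.
Qed.

Lemma adj_selfadjoint r f g : symmetric r ->
  \sum_u f u * adj r g u = \sum_u adj r f u * g u.
Proof.
move=> rS.
under eq_bigr => u _ do rewrite /adj mulr_sumr big_mkcond /=.
rewrite exchange_big /=; apply: eq_bigr => v _.
by rewrite /adj mulr_suml [RHS]big_mkcond; apply: eq_bigr => u _; rewrite rS.
Qed.

(** Half of the 2j factors move across the inner product by self-adjointness. Return counts become
    squared norms, to which an operator norm bound applies. *)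
Lemma iter_adj_return r (x : T) (j : nat) : symmetric r ->
  iter (2 * j) (adj r) (unit_at x) x = \sum_u iter j (adj r) (unit_at x) u ^+ 2.
Proof.
move=> rS.
have -> : iter (2 * j) (adj r) (unit_at x) x =
    \sum_u unit_at x u * iter (2 * j) (adj r) (unit_at x) u.
  rewrite (bigD1 x) //= big1 ?addr0 /unit_at ?eqxx ?mul1r //.
  by move=> u /negPf ->; rewrite mul0r.
rewrite mul2n -addnn iterD.
have shift i f g : \sum_u f u * iter i (adj r) g u = \sum_u iter i (adj r) f u * g u.
  elim: i f g => [//|i IH] f g.
  by rewrite iterSr IH adj_selfadjoint.
by rewrite shift; apply: eq_bigr => u _; rewrite expr2.
Qed.

(** Cauchy-Schwarz against an indicator: expand the square and use ab <= (a^2 + b^2)/2. *)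
Lemma sqr_sum_le (P : pred T) f :
  (\sum_(v | P v) f v) ^+ 2 <= #|P|%:R * \sum_(v | P v) f v ^+ 2.
Proof.
rewrite expr2 big_distrlr /=.
have H : \sum_(u | P u) \sum_(v | P v) f u * f v <=
         \sum_(u | P u) \sum_(v | P v) (f u ^+ 2 / 2 + f v ^+ 2 / 2).
  apply: ler_sum => u _; apply: ler_sum => v _.
  by have := sqr_ge0 (f u - f v); nra.
apply: le_trans H _; set Q := \sum_(v | P v) f v ^+ 2.
have inner u : \sum_(v | P v) (f u ^+ 2 / 2 + f v ^+ 2 / 2) =
    #|P|%:R * (f u ^+ 2 / 2) + Q / 2.
  by rewrite big_split /= sumr_const -mulr_suml mulr_natl.
rewrite (eq_bigr _ (fun u _ => inner u)) big_split /= sumr_const -mulr_sumr.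
by rewrite -mulr_suml -[X in _ + X <= _]mulr_natl -mulrDr -splitr.
Qed.

(** Cauchy-Schwarz on each row gives one factor D; symmetry then moves [adj r] onto a constant
    function, which gives the other. *)
Lemma adj_norm_le r f (D : nat) : symmetric r -> (forall u, (#|r u| <= D)%N) ->
  \sum_u adj r f u ^+ 2 <= D%:R ^+ 2 * \sum_u f u ^+ 2.
Proof.
move=> rS rD.
have H : \sum_u adj r f u ^+ 2 <= \sum_u D%:R * adj r (fun v => f v ^+ 2) u.
  apply: ler_sum => u _; apply: le_trans (sqr_sum_le _ _) _.
  apply: ler_wpM2r; last by rewrite ler_nat.
  by apply: sumr_ge0 => v _; apply: sqr_ge0.
apply: le_trans H _; rewrite (adj_selfadjoint _ _ rS) expr2 -mulrA mulr_sumr.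
rewrite mulr_sumr; apply: ler_sum => u _.
rewrite mulrA; apply: ler_wpM2r; first exact: sqr_ge0.
by rewrite /adj sumr_const -[X in X <= _]mulr_natl -!natrM ler_nat leq_mul2r rD orbT.
Qed.

(** The product of edge indicators vanishes on sequences that are not walks. Induction peels off the
    first step; [f := unit_at x] counts closed walks. *)
Lemma sum_walks r f m x :
  \sum_(w : {ffun 'I_m.+1 -> T} | w ord0 == x)
    (\prod_(i < m) (r (w (widen_ord (leqnSn m) i)) (w (lift ord0 i)))%:R) * f (w ord_max)
  = iter m (adj r) f x.
Proof.
elim: m x => [|m IH] x.
  rewrite (big_pred1 [ffun=> x]) /=.
    by rewrite big_ord0 mul1r ffunE.
  move=> w; apply/eqP/eqP => [<-|->]; last by rewrite ffunE.
  by apply/ffunP => i; rewrite ffunE (ord1 i).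
pose cons_walk (p : T * {ffun 'I_m.+1 -> T}) : {ffun 'I_m.+2 -> T} :=
  [ffun i => oapp p.2 p.1 (unlift ord0 i)].
pose uncons_walk (w : {ffun 'I_m.+2 -> T}) := (w ord0, [ffun i => w (lift ord0 i)]).
have cK : cancel uncons_walk cons_walk.
  move=> w; apply/ffunP => i; rewrite ffunE /=.
  by case: unliftP => [j|] ->; rewrite /= ?ffunE.
have uK : cancel cons_walk uncons_walk.
  case=> y w; rewrite /uncons_walk ffunE unlift_none /=; congr pair.
  by apply/ffunP => i; rewrite !ffunE liftK.
rewrite (reindex cons_walk) /=; last by exists uncons_walk => ? _; [apply: uK | apply: cK].
rewrite -(pair_big_dep (fun y => true) (fun y w => cons_walk (y, w) ord0 == x)
  (fun y w => (\prod_(i < m.+1) (r (cons_walk (y, w) (widen_ord (leqnSn m.+1) i))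
     (cons_walk (y, w) (lift ord0 i)))%:R) * f (cons_walk (y, w) ord_max))) /=.
have c0 y w : cons_walk (y, w) ord0 = y by rewrite ffunE unlift_none.
have cS y w i : cons_walk (y, w) (lift ord0 i) = w i by rewrite ffunE liftK.
rewrite (bigD1 x) //= [X in _ + X]big1 ?addr0; last first.
  by move=> y yx; rewrite big1 // => w; rewrite c0 (negPf yx).
rewrite /adj (eq_bigl xpredT); last by move=> w; rewrite c0 eqxx.
under [RHS]eq_bigr => v _ do rewrite -IH.
(* The tails are grouped by their first vertex, the second vertex of the whole walk. *)
rewrite (partition_big (fun w : {ffun 'I_m.+1 -> T} => w ord0) xpredT) //=.
rewrite [RHS]big_mkcond /=; apply: eq_bigr => v _.
have term (w : {ffun 'I_m.+1 -> T}) : w ord0 == v ->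
   (\prod_(i < m.+1) (r (cons_walk (x, w) (widen_ord (leqnSn m.+1) i))
     (cons_walk (x, w) (lift ord0 i)))%:R) * f (cons_walk (x, w) ord_max) =
   (r x v)%:R * ((\prod_(i < m) (r (w (widen_ord (leqnSn m) i)) (w (lift ord0 i)))%:R)
     * f (w ord_max)).
  move=> /eqP wv; rewrite big_ord_recl.
  have -> : widen_ord (leqnSn m.+1) ord0 = ord0 by apply: val_inj.
  have -> : ord_max = lift ord0 (ord_max : 'I_m.+1) by apply: val_inj.
  rewrite c0 !cS wv -mulrA; congr (_ * (_ * _)).
  apply: eq_bigr => i _.
  have -> : widen_ord (leqnSn m.+1) (lift ord0 i) = lift ord0 (widen_ord (leqnSn m) i).
    by apply: val_inj.
  by rewrite !cS.
rewrite (eq_bigr _ term) -mulr_sumr; case: (r x v); by rewrite ?mul1r ?mul0r.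
Qed.

End Adjacency.

(** * Closed walks confined to a small vertex set *)

Section Induced.
Variables (R : realType) (T : finType) (e : rel T).
Hypothesis e_sym : symmetric e.
Implicit Types (S : {set T}).

Definition induced S : rel T := [rel u v | [&& u \in S, v \in S & e u v]].

Lemma induced_sym S : symmetric (induced S).
Proof. by move=> u v; rewrite /induced /= e_sym andbCA. Qed.

Lemma iter_adj_outside S (x : T) m u : x \in S -> u \notin S ->
  iter m (adj (induced S)) (@unit_at R T x) u = 0.
Proof.
move=> xS uS; case: m => [|m] /=.
  by rewrite /unit_at; case: eqVneq uS => // ->; rewrite xS.
by rewrite /adj big_pred0 // => v; rewrite /induced /= (negPf uS).
Qed.

(** For u in S, split two-step moves by their middle vertex: those in S account for A_S^2 g, and
    each of the q or more outside neighbours gives an excursion back to u worth g u. For u outside S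
    the left side is 0. *)
Lemma adj_twice_gain S (g : T -> R) (q : nat) u :
  (forall v, 0 <= g v) -> (forall v, v \notin S -> g v = 0) ->
  (forall v, v \in S -> (q <= #|[set w | e v w] :\: S|)%N) ->
  adj (induced S) (adj (induced S) g) u + q%:R * g u <= adj e (adj e g) u.
Proof.
move=> g0 gS qS.
have adj0 (r : rel T) (f : T -> R) v : (forall w, 0 <= f w) -> 0 <= adj r f v.
  by move=> f0; apply: sumr_ge0.
case: (boolP (u \in S)) => uS; last first.
  rewrite gS // mulr0 addr0 {1}/adj big_pred0; last by move=> v; rewrite /induced /= (negPf uS).
  by do 2 apply: (adj0) => ?.
rewrite [X in _ <= X]/adj (bigID (mem S)) /=; apply: lerD.
  have -> : adj (induced S) (adj (induced S) g) u =
      \sum_(v | e u v && (v \in S)) adj (induced S) g v.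
    by apply: eq_bigl => v; rewrite /induced /= uS /= andbC.
  apply: ler_sum => v _; rewrite /adj [X in X <= _]big_mkcond [X in _ <= X]big_mkcond /induced /=.
  by apply: ler_sum => w _; case: (v \in S); case: (w \in S); case: (e v w) => //=.
have H : \sum_(v | e u v && (v \notin S)) g u <= \sum_(v | e u v && (v \notin S)) adj e g v.
  apply: ler_sum => v /andP[uv _]; rewrite /adj (bigD1 u) /=; last by rewrite e_sym.
  by rewrite lerDl sumr_ge0.
apply: le_trans H; rewrite sumr_const -[X in _ <= X]mulr_natl; apply: ler_wpM2r => //.
rewrite ler_nat; apply: leq_trans (qS _ uS) _.
by apply: eq_leq; apply: eq_card => v; rewrite !inE andbC.
Qed.

Lemma closed_walks_induced_le S (x : T) (m k : nat) : (0 < m)%N -> x \in S ->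
  (#|S| <= m)%N -> (forall v, (2 * m <= #|[set w | e v w]|)%N) ->
  (1 + m%:R^-1) ^+ k * iter (2 * k) (adj (induced S)) (@unit_at R T x) x <=
  iter (2 * k) (adj e) (@unit_at R T x) x.
Proof.
move=> m0 xS Sm deg.
pose g j := iter (2 * j) (adj (induced S)) (@unit_at R T x).
have u0 u : 0 <= @unit_at R T x u by apply: ler0n.
(* Degrees inside S are at most |S| <= m, so the norm bound applies to A_S^j 1_x. *)
have gD j : g j.+1 x <= m%:R ^+ 2 * g j x.
  rewrite /g !iter_adj_return /=; try exact: induced_sym.
  apply: adj_norm_le => [|u]; first exact: induced_sym.
  apply: leq_trans Sm; apply: subset_leq_card; apply/subsetP => v.
  by case/and3P.
have qS v : v \in S -> (m <= #|[set w | e v w] :\: S|)%N.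
  move=> _; rewrite cardsD leq_subRL; last by rewrite subset_leq_card // subsetIl.
  apply: leq_trans (deg v); rewrite mul2n -addnn leq_add2r.
  by apply: leq_trans Sm; rewrite subset_leq_card // subsetIr.
(* Mixed products A^(2i) A_S^(2j) allow induction on i for all j at once; the claim is i = k, j =
   0. *)
suff main i j : (1 + m%:R^-1) ^+ i * g (i + j)%N x <= iter (2 * i) (adj e) (g j) x.
  by have := main k 0%N; rewrite addn0.
elim: i j => [|i IH] j; first by rewrite expr0 mul1r.
have step : iter (2 * i) (adj e) (g j.+1) x + m%:R * iter (2 * i) (adj e) (g j) x <=
    iter (2 * i.+1) (adj e) (g j) x.
  have -> : iter (2 * i.+1) (adj e) (g j) x = iter (2 * i) (adj e) (adj e (adj e (g j))) x.
    by rewrite mulnS addnC iterD.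
  have {1}-> : g j.+1 = adj (induced S) (adj (induced S) (g j)) by rewrite /g mulnS.
  rewrite -[X in X <= _]/((fun u => _ + _ * _) x) -iter_adjDZ; apply: le_iter_adj => u; apply: adj_twice_gain => // v.
    exact: iter_adj_ge0.
  exact: iter_adj_outside.
apply: le_trans step.
have mR : 0 < m%:R :> R by rewrite ltr0n.
have := IH j; have := IH j.+1; rewrite addnS => h1 h2.
(* The additive gain m g(i+j) is at least g(i+j+1)/m, which makes it the multiplicative gain 1 +
   1/m. *)
have h3 : g (i + j).+1 x / m%:R <= m%:R * g (i + j)%N x.
  by rewrite ler_pdivrMr // mulrAC -expr2.
have r0 : 0 <= (1 + m%:R^-1 : R) ^+ i by rewrite exprn_ge0 // addr_ge0 // invr_ge0 ltW.
have h4 := ler_wpM2l r0 h3.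
have h5 := ler_wpM2l (ltW mR) h2.
rewrite exprS addSn.
have -> : (1 + m%:R^-1) * (1 + m%:R^-1) ^+ i * g (i + j).+1 x =
  (1 + m%:R^-1) ^+ i * g (i + j).+1 x + (1 + m%:R^-1) ^+ i * (g (i + j).+1 x / m%:R) by ring.
apply: lerD => //; apply: le_trans h4 _; apply: le_trans h5.
by rewrite mulrCA.
Qed.

End Induced.

(** * Counting the possible supports *)

Section Supports.
Variables (T : finType) (e : rel T).

Fixpoint grown_sets (x : T) (i : nat) : {set {set T}} :=
  if i is j.+1 then
    grown_sets x j :|:
    \bigcup_(S in grown_sets x j) \bigcup_(u in S) [set v |: S | v in [set v | e u v]]
  else [set [set x]].

Lemma leq_card_bigcup (I U : finType) (A : {set I}) (F : I -> {set U}) (c : nat) :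
  (forall i, i \in A -> (#|F i| <= c)%N) -> (#|\bigcup_(i in A) F i| <= #|A| * c)%N.
Proof.
move=> Fc; rewrite -sum_nat_const.
apply: leq_trans (leq_sum _ Fc).
elim/big_ind2: _ => [|B a C b Ba Cb|//]; first by rewrite cards0.
by apply: leq_trans (leq_card_setU _ _) _; apply: leq_add.
Qed.

Lemma grown_sets_sub x i j : (i <= j)%N -> grown_sets x i \subset grown_sets x j.
Proof.
elim: j => [|j IH]; first by rewrite leqn0 => /eqP ->.
rewrite leq_eqVlt => /orP[/eqP -> //|]; rewrite ltnS => /IH ij.
exact: subset_trans ij (subsetUl _ _).
Qed.

Lemma card_grown_set x i S : S \in grown_sets x i -> (#|S| <= i.+1)%N.
Proof.
elim: i S => [|i IH] S /=; first by move/set1P ->; rewrite cards1.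
case/setUP => [/IH /leqW //|/bigcupP[S' /IH S'i /bigcupP[u _ /imsetP[v _ ->]]]].
by rewrite cardsU1; case: (v \notin S') => //=; rewrite ?add1n ?add0n // leqW.
Qed.

(** A set at a stage before m has at most m elements. It is either kept or extended through one of
    its vertices and one of at most d neighbours, hence the factor 1 + m d per stage. *)
Lemma card_grown_sets x m d i : (i <= m)%N -> (forall u, #|[set v | e u v]| <= d)%N ->
  (#|grown_sets x i| <= (1 + m * d) ^ i)%N.
Proof.
move=> im deg; elim: i im => [|i IH] im /=; first by rewrite cards1.
apply: leq_trans (leq_card_setU _ _) _.
rewrite expnS mulnDl mul1n; apply: leq_add; first by apply: IH; apply: ltnW.
have H : (#|\bigcup_(S in grown_sets x i) \bigcup_(u in S)
    [set v |: S | v in [set v | e u v]]| <= #|grown_sets x i| * (m * d))%N.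
  apply: leq_card_bigcup => S /card_grown_set Si.
  apply: leq_trans (leq_mul (leq_trans Si im) (leqnn d)).
  apply: leq_card_bigcup => u _.
  exact: leq_trans (leq_imset_card _ _) (deg u).
apply: leq_trans H _; rewrite mulnC leq_mul2l IH ?orbT //; exact: ltnW.
Qed.

Lemma support_grown x m (w : {ffun 'I_m.+1 -> T}) : w ord0 = x ->
  (forall i : 'I_m, e (w (widen_ord (leqnSn m) i)) (w (lift ord0 i))) ->
  [set w i | i : 'I_m.+1] \in grown_sets x (walk_support w).
Proof.
move=> w0 we.
pose U i := [set w j | j : 'I_m.+1 & (j <= i)%N].
have Usucc i (im : (i < m)%N) : U i.+1 = w (lift ord0 (Ordinal im)) |: U i.
  apply/setP => v; apply/imsetP/setU1P => [[j]|[->|/imsetP[j]]].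
  - rewrite inE leq_eqVlt => /orP[/eqP ji|ji] ->.
      by left; congr (w _); apply: val_inj.
    by right; apply: imset_f; rewrite inE.
  - by exists (lift ord0 (Ordinal im)) => //; rewrite inE.
  - by rewrite inE => ji ->; exists j => //; rewrite inE leqW.
have Upos i : (0 < #|U i|)%N.
  by apply/card_gt0P; exists (w ord0); apply: imset_f; rewrite inE.
(* The stage counts vertices added after x, not elapsed time: a step to a visited vertex leaves
   [U i] unchanged, and a new vertex is a neighbour of the current one. *)
have main i : (i <= m)%N -> U i \in grown_sets x #|U i|.-1.
  elim: i => [_|i IH im].
    have -> : U 0%N = [set x].
      apply/setP => v; rewrite inE; apply/imsetP/eqP => [[j]|->].
        by rewrite inE leqn0 => /eqP j0 ->; rewrite -w0; congr (w _); apply: val_inj.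
      by exists ord0; rewrite ?inE.
    by rewrite cards1 /= inE.
  have := IH (ltnW im); rewrite (Usucc _ im) cardsU1.
  case: (boolP (_ \in U i)) => [wU|_] Ui.
    by rewrite add0n (setUidPr _) ?sub1set.
  rewrite add1n /= -(prednK (Upos i)) /=.
  apply/setUP; right; apply/bigcupP; exists (U i) => //.
  apply/bigcupP; exists (w (widen_ord (leqnSn m) (Ordinal im))).
    by apply: imset_f; rewrite inE /=.
  by apply: imset_f; rewrite inE.
have -> : [set w i | i : 'I_m.+1] = U m.
  apply/setP => v; apply/imsetP/imsetP => [[j _ ->]|[j _ ->]]; exists j => //.
  by rewrite inE -ltnS.
have -> : walk_support w = #|U m|.
  rewrite /walk_support; apply: eq_card => v.
  apply/imsetP/imsetP => [[j _ ->]|[j _ ->]]; exists j => //.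
  by rewrite inE -ltnS.
by apply: (subsetP (grown_sets_sub x (leq_pred _))); apply: main.
Qed.

End Supports.

(** * Union bound over supports *)

Section SmallSupport.
Variables (R : realType) (T : finType) (e : rel T) (d : nat).
Hypotheses (e_sym : symmetric e) (e_reg : regular_graph e d).

(** By regularity all walks of length m from x have weight d^(-m), which turns probabilities into
    walk counts. *)
Lemma srw_law_regular x m (w : {ffun 'I_m.+1 -> T}) :
  srw_law R e x w = d%:R^-1 ^+ m *
    ((w ord0 == x)%:R * \prod_(i < m) (e (w (widen_ord (leqnSn m) i)) (w (lift ord0 i)))%:R).
Proof.
rewrite /srw_law mulrCA; congr (_ * _).
under eq_bigr => i _ do rewrite /srw_step e_reg.
by rewrite big_split /= prodr_const card_ord mulrC.
Qed.

Lemma srw_Pr_regular x m (A : pred {ffun 'I_m.+1 -> T}) :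
  srw_Pr R e x A = d%:R^-1 ^+ m * \sum_(w : {ffun 'I_m.+1 -> T} | w ord0 == x)
    (\prod_(i < m) (e (w (widen_ord (leqnSn m) i)) (w (lift ord0 i)))%:R) * (A w)%:R.
Proof.
rewrite /srw_Pr mulr_sumr big_mkcond [RHS]big_mkcond; apply: eq_bigr => w _.
rewrite srw_law_regular.
by case: (A w); case: (w ord0 == x); rewrite ?mul1r ?mulr1 ?mul0r ?mulr0.
Qed.

Lemma srw_Pr_return x m :
  srw_Pr R e x (@closed_walk T m) = d%:R^-1 ^+ m * iter m (adj e) (@unit_at R T x) x.
Proof.
rewrite srw_Pr_regular -sum_walks; congr (_ * _); apply: eq_bigr => w /eqP w0.
by rewrite /unit_at /closed_walk w0.
Qed.

Lemma srw_Pr_small_support x (m k : nat) : (0 < m)%N -> (2 * m <= d)%N ->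
  srw_Pr R e x [pred w : {ffun 'I_(2 * k).+1 -> T} |
    closed_walk w && (walk_support w <= m)%N]
  <= ((1 + m * d) ^ m)%:R * (1 + m%:R^-1) ^- k * srw_Pr R e x (@closed_walk T (2 * k)).
Proof.
move=> m0 md; rewrite srw_Pr_regular srw_Pr_return mulrCA.
apply: ler_wpM2l; first by rewrite exprn_ge0 ?invr_ge0.
set M := (2 * k)%N.
pose cnt (r : rel T) (w : {ffun 'I_M.+1 -> T}) : R :=
  \prod_(i < M) (r (w (widen_ord (leqnSn M) i)) (w (lift ord0 i)))%:R.
have cnt0 r w : 0 <= cnt r w by apply: prodr_ge0.
(* The edge condition is made explicit so that [support_grown] applies; sequences violating it have
   weight 0. *)
pose small (w : {ffun 'I_M.+1 -> T}) := [&& w ord0 == x,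
  [forall i : 'I_M, e (w (widen_ord (leqnSn M) i)) (w (lift ord0 i))],
  closed_walk w & (walk_support w <= m)%N].
have -> : \sum_(w : {ffun 'I_M.+1 -> T} | w ord0 == x)
    cnt e w * ([pred w | closed_walk w && (walk_support w <= m)%N] w)%:R =
    \sum_(w | small w) cnt e w.
  rewrite big_mkcond [RHS]big_mkcond; apply: eq_bigr => w _; rewrite /small /=.
  case: (w ord0 == x) => //=; case: forallP => /= [_|we].
    by case: (_ && _); rewrite ?mulr1 ?mulr0.
  have [i /negbTE ei] : exists i : 'I_M, ~~ e (w (widen_ord (leqnSn M) i)) (w (lift ord0 i)).
    by apply/existsP; rewrite -negb_forall; apply/forallP.
  by rewrite /cnt (bigD1 i) //= ei !mul0r.
pose supp (w : {ffun 'I_M.+1 -> T}) := [set w i | i : 'I_M.+1].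
pose Q (S : {set T}) := (S \in grown_sets e x m) && ((x \in S) && (#|S| <= m)%N).
have smallQ w : small w -> Q (supp w).
  case/and4P => /eqP w0 /forallP we _ wm; rewrite /Q; apply/and3P; split => //.
    exact: (subsetP (grown_sets_sub e x wm)) (support_grown w0 we).
  by rewrite -w0; apply: imset_f.
rewrite (partition_big supp Q) //=.
set r := 1 + m%:R^-1; have r0 : 0 < r by rewrite addr_gt0 // invr_gt0 ltr0n.
set N := iter M (adj e) _ _.
have N0 : 0 <= N by apply: iter_adj_ge0 => u; apply: ler0n.
have each S : Q S -> \sum_(w | small w && (supp w == S)) cnt e w <= r ^- k * N.
  case/and3P => _ xS Sm.
  rewrite ler_pdivlMl ?exprn_gt0 //.
  apply: le_trans (closed_walks_induced_le R e_sym k m0 xS Sm _); last first.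
    by move=> v; rewrite -/(degree e v) e_reg.
  apply: ler_wpM2l; first by rewrite exprn_ge0 // ltW.
  (* A walk with support exactly S uses only edges induced on S, so it is among the closed walks
     counted by A_S. *)
  rewrite -sum_walks big_mkcond [X in _ <= X]big_mkcond; apply: ler_sum => w _ /=.
  rewrite -/M -/(cnt (induced e S) w).
  case: ifP => [/andP[/and4P[w0 _ /eqP wc _] /eqP wS]|_]; last first.
    by case: ifP => // _; rewrite mulr_ge0 ?cnt0 ?ler0n.
  rewrite w0 /unit_at wc w0 mulr1 /cnt; apply: ler_prod => i _.
  by rewrite ler0n /induced /= -wS /supp !imset_f.
apply: (@le_trans _ _ (\sum_(S | Q S) (r ^- k * N))); first exact: ler_sum.
rewrite sumr_const -[X in X <= _]mulr_natl -mulrA.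
apply: ler_wpM2r; first by rewrite mulr_ge0 ?invr_ge0 ?exprn_ge0 // ltW.
have count : (#|grown_sets e x m| <= (1 + m * d) ^ m)%N.
  by apply: card_grown_sets => // u; rewrite -/(degree e u) e_reg.
rewrite ler_nat; apply: leq_trans count.
by apply: subset_leq_card; apply/subsetP => S /andP[].
Qed.

End SmallSupport.

(** * Numerical estimates and the tail bound *)

Lemma union_bound_le_expR (R : realType) (m d k : nat) (s : R) : (0 < m)%N ->
  m%:R <= s -> s <= d%:R / 2 -> 4096 * s ^+ 4 * ln d%:R <= k%:R ->
  ((1 + m * d) ^ m)%:R * (1 + m%:R^-1) ^- k <= expR (- (k%:R / (100 * s ^+ 3))).
Proof.
move=> m0 ms sd sk.
have mR : 1 <= m%:R :> R by rewrite ler1n.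
have s1 : 1 <= s by apply: le_trans mR ms.
have d2 : 2 <= d%:R :> R by lra.
have lnd : 0 < ln (d%:R : R) by apply: ln_gt0; lra.
(* Since 2m <= d and d >= 2, 1 + m d <= 1 + d^2/2 <= d^2. *)
have c1 : ((1 + m * d) ^ m)%:R <= expR (2 * m%:R * ln d%:R) :> R.
  rewrite natrX natrD natrM -mulrA mulrCA expRM_natl.
  apply: lerXn2r; rewrite ?nnegrE ?expR_ge0 //; first by nra.
  rewrite expRM_natl lnK ?posrE; last by lra.
  by nra.
(* Here 1/(1 + 1/m) = 1 - 1/(m+1), and m + 1 <= 2s because m <= s and 1 <= s. *)
have c2 : (1 + m%:R^-1) ^- k <= expR (- (k%:R / (2 * s))) :> R.
  rewrite -mulrN expRM_natl -exprVn; apply: lerXn2r.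
  - by rewrite nnegrE invr_ge0 addr_ge0 // invr_ge0.
  - by rewrite nnegrE expR_ge0.
  apply: le_trans (expR_ge1Dx _).
  have -> : (1 + m%:R^-1)^-1 = 1 - (1 + m%:R)^-1 :> R by field; lra.
  rewrite lerD2l lerN2 lef_pV2 ?posrE; lra.
apply: le_trans (ler_pM _ _ c1 c2) _ => //.
  by rewrite invr_ge0 exprn_ge0 // addr_ge0 // invr_ge0.
rewrite -expRD ler_expR.
have s3 : 0 < s ^+ 3 by rewrite exprn_gt0 //; lra.
set L := ln _ in lnd sk *; set K := k%:R in sk *.
have K0 : 0 <= K by rewrite /K.
have h1 : 2 * m%:R * L <= K / (2048 * s ^+ 3).
  rewrite ler_pdivlMr; last by lra.
  apply: le_trans sk; have -> : 4096 * s ^+ 4 * L = (2 * s * L) * (2048 * s ^+ 3) by ring.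
  apply: ler_wpM2r; first by lra.
  by apply: ler_wpM2r; lra.
have h2 : K / (2 * s ^+ 3) <= K / (2 * s).
  apply: ler_wpM2l => //; rewrite lef_pV2 ?posrE; [|lra|lra].
  by rewrite ler_pM2l // exprS; nra.
have [E1 E2 E3] : [/\ K / (2048 * s ^+ 3) = K / s ^+ 3 / 2048,
   K / (2 * s ^+ 3) = K / s ^+ 3 / 2 & K / (100 * s ^+ 3) = K / s ^+ 3 / 100].
  by split; field; lra.
(* In units of K/s^3 the exponent is at most 1/2048 - 1/2, below -1/100. *)
have : 0 <= K / s ^+ 3 by rewrite divr_ge0 // ltW.
by lra.
Qed.

Theorem theorem1p8 (R : realType) (T : finType) (e : rel T) (n d k : nat)
    (x : T) (s : R)
    (Gsimple : simple_graph e) (Gregular : regular_graph e d)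
    (Gconnected : connected_graph e) (Gorder : #|T| = n)
    (k_ge1 : (1 <= k)%N) (k_lt : (2 * k < n)%N)
    (s_gt0 : 0 < s)
    (s_le : s <= Num.min (8^-1 * (k%:R / ln d%:R) `^ (4^-1)) (d%:R / 2)) :
  closed_walk_Pr R e x
    [pred w : {ffun 'I_(2 * k).+1 -> T} | (walk_support w)%:R <= s]
  <= expR (- (k%:R / (100 * s ^+ 3))).
Proof.
case: Gsimple => e_sym _; move: s_le; rewrite le_min => /andP[sk sd].
(* The support size is an integer, so s may be replaced by its integer part in the event. *)
pose m := Num.truncn s.
have ms : m%:R <= s by rewrite truncn_le ltW.
have small w : ((@walk_support T (2 * k) w)%:R <= s) = (walk_support w <= m)%N.
  by rewrite truncn_ge_nat // ltW.
rewrite /closed_walk_Pr.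
have -> : srw_Pr R e x [pred w : {ffun 'I_(2 * k).+1 -> T} | closed_walk w &&
    [pred w : {ffun 'I_(2 * k).+1 -> T} | (walk_support w)%:R <= s] w] =
  srw_Pr R e x [pred w : {ffun 'I_(2 * k).+1 -> T} |
    closed_walk w && (walk_support w <= m)%N].
  by apply: eq_bigl => w /=; rewrite small.
(* If s < 1 the event is empty, since a walk visits its starting vertex. *)
have [m0|m0] := posnP m.
  rewrite {1}/srw_Pr big_pred0 ?mul0r ?expR_ge0 // => w /=.
  rewrite m0 leqn0 cards_eq0; apply/negbTE; rewrite negb_and orbC.
  by apply/orP; left; apply/set0Pn; exists (w ord0); apply: imset_f.
have md : (2 * m <= d)%N by rewrite -(ler_nat R) natrM; lra.
have P0 : 0 <= srw_Pr R e x (@closed_walk T (2 * k)).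
  rewrite (srw_Pr_return R Gregular) mulr_ge0 ?exprn_ge0 ?invr_ge0 //.
  by apply: iter_adj_ge0 => u; apply: ler0n.
have lnd : 0 < ln (d%:R : R).
  by apply: ln_gt0; rewrite ltr1n; apply: leq_trans md; rewrite leq_pmulr.
(* Fourth power of 8s <= (k / log d)^(1/4), with 4096 = 8^4; log d > 0 comes from d >= 2m >= 2. *)
have sk4 : 4096 * s ^+ 4 * ln d%:R <= k%:R.
  have q0 : 0 <= k%:R / ln (d%:R : R) by rewrite divr_ge0 // ltW.
  rewrite -ler_pdivlMr //.
  set P := _ `^ _ in sk; have P_ge0 : 0 <= P by apply: powR_ge0.
  have P4 : P ^+ 4 = k%:R / ln d%:R.
    by rewrite -powR_mulrn // /P -powRrM mulVf ?pnatr_eq0 // powRr1.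
  have h : 8 * s <= P by lra.
  have -> : 4096 * s ^+ 4 = (8 * s) ^+ 4 by ring.
  by rewrite -P4; apply: lerXn2r; rewrite // nnegrE mulr_ge0 // ltW.
have bound := union_bound_le_expR m0 ms sd sk4.
have H := srw_Pr_small_support R e_sym Gregular x k m0 md.
(* A zero return probability would make the quotient 0 by the convention on division. *)
move: P0; rewrite le_eqVlt => /orP[/eqP <-|P0]; first by rewrite invr0 mulr0 expR_ge0.
rewrite ler_pdivrMr //; apply: le_trans H _.
by apply: ler_wpM2r; rewrite // ltW.
Qed.
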